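(* Let $n\ge 4$ and $k\ge 1$ be integers. Then \[ \gamma_{[k]R}(C_5\Box P_n)\le 5(n-2)\left\lceil\frac{k+4}{5}\right\rceil+10\left\lceil\frac{k+3-\left\lceil\frac{k+4}{5}\right\rceil}{3}\right\rceil\le \frac{3nk+27n+2k-2}{3}. \]
   Context: For a graph $G$ and $v\in V(G)$, $N(v)$ is the open neighborhood and $N[v]=N(v)\cup\{v\}$. For an integer $k\ge1$, a function $f:V(G)\to\{0,1,\dots,k+1\}$ is a $[k]$-Roman dominating function if for every vertex $v$ with $f(v)<k$ we have $\sum_{u\in N[v]}f(u)\ge k+|\{u\in N(v): f(u)>0\}|$. The weight of $f$ is $\sum_{v}f(v)$, and $\gamma_{[k]R}(G)$ is the minimum weight of a $[k]$-Roman dominating function on $G$. $C_m\Box P_n$ is the Cartesian product of the cycle $C_m$ (vertices $0,\dots,m-1$ mod $m$) and the path $P_n$ (vertices $0,\dots,n-1$): $(i,j)\sim(i',j')$ iff ($i=i'$ and $|j-j'|=1$) or ($j=j'$ and $i'\equiv i\pm1 \pmod m$). *)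

(* Defs.v *)
From mathcomp Require Import all_boot all_order all_algebra.

Set Implicit Arguments.
Unset Strict Implicit.
Unset Printing Implicit Defensive.

(* A finite simple graph on T is given by its adjacency relation e : rel T,
   symmetric and irreflexive. *)

Section RomanDomination.

Variables (T : finType) (e : rel T) (k : nat).

Definition open_nbhd (v : T) : {set T} := [set u | e v u].

Definition closed_nbhd (v : T) : {set T} := v |: open_nbhd v.

(* The values 0, 1, ..., k+1 are the elements of 'I_k.+2. *)
Definition kRoman_dominating (f : {ffun T -> 'I_k.+2}) : bool :=
  [forall v, (f v < k) ==>
    (k + #|[set u in open_nbhd v | 0 < f u]|
       <= \sum_(u in closed_nbhd v) f u)].

Definition weight (f : {ffun T -> 'I_k.+2}) : nat := \sum_v f v.

(* The constant function k+1, always [k]-Roman dominating, only serves as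
   the starting point that arg min requires. *)
Definition gamma_kR : nat :=
  weight [arg min_(f < [ffun=> ord_max] | kRoman_dominating f) weight f].

Lemma kRoman_dominating_max : kRoman_dominating [ffun=> ord_max].
Proof. by apply/forallP=> v; rewrite ffunE /= ltnNge leqnSn. Qed.

Lemma gamma_kR_attained :
  exists2 f : {ffun T -> 'I_k.+2}, kRoman_dominating f & weight f = gamma_kR.
Proof.
rewrite /gamma_kR; case: arg_minnP; first exact: kRoman_dominating_max.
by move=> f domf _; exists f.
Qed.

Lemma gamma_kR_le (f : {ffun T -> 'I_k.+2}) :
  kRoman_dominating f -> gamma_kR <= weight f.
Proof.
rewrite /gamma_kR; case: arg_minnP; first exact: kRoman_dominating_max.
by move=> g _; apply.
Qed.

End RomanDomination.

(* A simple graph only for m >= 3. *)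
Definition cycle_graph (m : nat) : rel 'I_m :=
  fun i j => (j == i + 1 %[mod m]) || (i == j + 1 %[mod m]).
Arguments cycle_graph m i j : clear implicits.

Definition path_graph (n : nat) : rel 'I_n :=
  fun i j => (j == i + 1 :> nat) || (i == j + 1 :> nat).
Arguments path_graph n i j : clear implicits.

Definition cartesian_product (T1 T2 : finType) (e1 : rel T1) (e2 : rel T2) :
    rel (T1 * T2) :=
  fun x y => (x.1 == y.1) && e2 x.2 y.2 || (x.2 == y.2) && e1 x.1 y.1.

(* Main.v *)
(* Put the constant a = ceil((k + 4) / 5) on the interior copies of C_5 and
   b = ceil((k + 3 - a) / 3) on the two end copies. All values are positive, so
   a vertex of degree d is dominated as soon as its closed neighborhood has
   weight k + d: this reads a + 3 b >= k + 3 on the end copies, 4 a + b >= k + 4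
   next to them, and 5 a >= k + 4 elsewhere. The second inequality follows from
   the other two: 15 (4 a + b) >= 55 a + 5 (k + 3) >= 16 k + 59 >= 15 (k + 4). *)
Require Import Defs.
From mathcomp Require Import all_boot all_order all_algebra.
From mathcomp Require Import zify.
Import Order.TTheory GRing.Theory Num.Theory.
Local Open Scope ring_scope.

(** Floor division after adding [d] rounds up. This turns the rational ceilings of the theorem into
    natural numbers within reach of [lia]. *)
Lemma ceil_divn (m d : nat) :
  Num.ceil (m%:R / d.+1%:R : rat) = ((m + d) %/ d.+1)%N%:Z.
Proof.
have d_gt0 : 0 < d.+1%:R :> rat by rewrite ltr0n.
apply: ceil_def; rewrite ltr_pdivlMr // ler_pdivrMr //.
rewrite rmorphB /= mulrBl mul1r -[(Posz _)%:~R]/(((m + d) %/ d.+1)%:R).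
rewrite ltrBlDr -!natrM -natrD ltr_nat ler_nat.
by clear; lia.
Qed.

Local Open Scope nat_scope.

(** Split the neighbors by whether their first coordinate is [i]; irreflexivity leaves just one kind
    of edge in each part. *)
Lemma sum_cartesian_product (T1 T2 : finType) (e1 : rel T1) (e2 : rel T2)
    (F : T1 * T2 -> nat) (i : T1) (j : T2) :
  irreflexive e1 -> irreflexive e2 ->
  \sum_(u in open_nbhd (cartesian_product e1 e2) (i, j)) F u
    = \sum_(j' | e2 j j') F (i, j') + \sum_(i' | e1 i i') F (i', j).
Proof.
move=> irr1 irr2.
rewrite (bigID (fun u => u.1 == i)) /=; congr (_ + _).
  rewrite (reindex_onto (pair i) snd) /=.
    apply: eq_bigl => j'.
    by rewrite inE /cartesian_product /= irr1 !eqxx andbF orbF !andbT.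
  by case=> i' j' /andP[_ /eqP /= ->].
rewrite (reindex_onto (fun i' => (i', j)) fst) /=.
  apply: eq_bigl => i'.
  rewrite inE /cartesian_product /= irr2 !eqxx andbF /= andbT.
  by case: eqP => [->|]; rewrite ?irr1 ?andbT.
case=> i' j' /andP[]; rewrite inE /cartesian_product /= eq_sym.
by case: (i' == i) => //= /andP[/eqP ->].
Qed.

Lemma sum_path_graph (n : nat) (g : nat -> nat) (j : 'I_n) :
  \sum_(j' | path_graph n j j') g j'
    = (if 0 < j then g j.-1 else 0) + (if j.+1 < n then g j.+1 else 0).
Proof.
rewrite (bigID (fun j' : 'I_n => j' < j)) /=; congr (_ + _).
  case: ifP => j_gt0.
    have lt_pj : j.-1 < n by have := ltn_ord j; lia.
    rewrite (big_pred1 (Ordinal lt_pj)) // => j'.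
    by rewrite /path_graph /= -val_eqE /=; lia.
  by rewrite big1 // => j'; lia.
case: ifP => lt_sj.
  rewrite (big_pred1 (Ordinal lt_sj)) // => j'.
  by rewrite /path_graph /= -val_eqE /=; lia.
by rewrite big1 // => j'; rewrite /path_graph; have := ltn_ord j'; lia.
Qed.

Lemma card_cycle_graph5 (i : 'I_5) : #|[pred i' | cycle_graph 5 i i']| = 2.
Proof.
rewrite -sum1_card big_mkcond !big_ord_recl big_ord0.
by case: i => [[|[|[|[|[|i]]]]] lt_i5].
Qed.

Lemma cycle_graph_irr (m : nat) : 1 < m -> irreflexive (cycle_graph m).
Proof.
move=> m_gt1 i; rewrite /cycle_graph orbb -{1}[nat_of_ord i]addn0 eqn_modDl.
by rewrite mod0n modn_small.
Qed.

Lemma path_graph_irr (n : nat) : irreflexive (path_graph n).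
Proof. by move=> j; rewrite /path_graph; lia. Qed.

Lemma sum_open_nbhd_C5_path (n : nat) (g : nat -> nat) (i : 'I_5) (j : 'I_n) :
  \sum_(u in open_nbhd (cartesian_product (cycle_graph 5) (path_graph n)) (i, j))
    g u.2
  = (if 0 < j then g j.-1 else 0) + (if j.+1 < n then g j.+1 else 0) + 2 * g j.
Proof.
rewrite sum_cartesian_product /= ?sum_path_graph; last exact: path_graph_irr.
  by rewrite sum_nat_const card_cycle_graph5.
exact: cycle_graph_irr.
Qed.

(** With all values positive, the neighbors counted are all of [open_nbhd e v]. The degree is
    written as a sum of ones so that one summation formula serves both sides. *)
Lemma kRoman_dominating_pos (T : finType) (e : rel T) (k : nat)
    (f : {ffun T -> 'I_k.+2}) :
  irreflexive e -> (forall v, 0 < f v) ->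
  (forall v,
     k + \sum_(u in open_nbhd e v) 1 <= f v + \sum_(u in open_nbhd e v) f u) ->
  kRoman_dominating e f.
Proof.
move=> irr f_gt0 domf; apply/forallP => v; apply/implyP => _; have := domf v.
rewrite /closed_nbhd big_setU1 ?inE ?irr //= sum1_card.
congr (_ + _ <= _); apply: eq_card => u.
by rewrite [RHS]inE f_gt0 andbT.
Qed.

Definition two_level (n a b j : nat) : nat :=
  if (j == 0) || (j == n.-1) then b else a.

Lemma gamma_kR_C5_path_le (n k a b : nat) :
  4 <= n -> 1 <= k -> 0 < a <= k.+1 -> 0 < b <= k.+1 ->
  k + 3 <= a + 3 * b -> k + 4 <= 5 * a ->
  gamma_kR (cartesian_product (cycle_graph 5) (path_graph n)) k
    <= 5 * (n - 2) * a + 10 * b.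
Proof.
move=> n_ge4 k_gt0 /andP[a_gt0 le_ak] /andP[b_gt0 le_bk] endP midP.
have g_gt0 j : 0 < two_level n a b j by rewrite /two_level; case: ifP.
have g_le j : two_level n a b j < k.+2 by rewrite /two_level; case: ifP.
pose f : {ffun 'I_5 * 'I_n -> 'I_k.+2} :=
  [ffun u : 'I_5 * 'I_n => inord (two_level n a b u.2)].
have fE u : f u = two_level n a b u.2 :> nat by rewrite ffunE inordK.
have /gamma_kR_le : kRoman_dominating
    (cartesian_product (cycle_graph 5) (path_graph n)) f.
  apply: kRoman_dominating_pos => [[i j]|u|[i j]]; last 1 first.
  - under [in X in _ <= X]eq_bigr do rewrite fE.
    rewrite (sum_open_nbhd_C5_path _ (fun=> 1)) sum_open_nbhd_C5_path fE /=.
    (* As [n >= 4], no level is adjacent to both ends, so only three kinds of level occur. *)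
    move: (nat_of_ord j) (ltn_ord j) => {}j lt_jn; rewrite /two_level.
    by clear f fE g_gt0 g_le; do !case: ifP; lia.
  - by rewrite /cartesian_product /= path_graph_irr cycle_graph_irr ?andbF.
  - by rewrite fE.
suff -> : weight f = 5 * (n - 2) * a + 10 * b by [].
rewrite /weight; under eq_bigr do rewrite fE.
rewrite -(pair_big predT predT (fun _ (j : 'I_n) => two_level n a b j)) /=.
rewrite sum_nat_const card_ord.
case: n n_ge4 {g_gt0 g_le f fE} => [|[|n]] // _.
(* Here [n] stands for the former [n - 2]: peeling off both ends leaves [n] interior levels. *)
rewrite big_ord_recl big_ord_recr /=.
rewrite (eq_bigr (fun=> a)) => [|j _]; last first.
  by rewrite /two_level /bump /=; have := ltn_ord j; case: ifP => //; lia.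
rewrite sum_nat_const card_ord /two_level /bump /=.
by rewrite add1n eqxx; lia.
Qed.

Local Open Scope ring_scope.

Theorem theorem5 (n k : nat) (hn : (4 <= n)%N) (hk : (1 <= k)%N) :
  (gamma_kR (cartesian_product (cycle_graph 5) (path_graph n)) k)%:R
    <= (5 * (n%:R - 2) * (Num.ceil ((k%:R + 4) / 5 : rat))%:~R
        + 10 * (Num.ceil
                  ((k%:R + 3 - (Num.ceil ((k%:R + 4) / 5 : rat))%:~R) / 3
                    : rat))%:~R : rat)
    <= (3 * n%:R * k%:R + 27 * n%:R + 2 * k%:R - 2) / 3.
Proof.
rewrite -natrD ceil_divn; set a := (_ %/ 5)%N.
have a_lo : (k + 4 <= 5 * a)%N by rewrite /a; lia.
have a_hi : (5 * a <= k + 8)%N by rewrite /a; lia.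
rewrite -natrD -[(Posz a)%:~R]/(a%:R) -[(k + 3)%:R - _]natrB ?ceil_divn; last by lia.
set b := (_ %/ 3)%N; rewrite -[(Posz b)%:~R]/(b%:R).
have b_lo : (k + 3 <= a + 3 * b)%N by rewrite /b; lia.
have b_hi : (a + 3 * b <= k + 5)%N by rewrite /b; lia.
apply/andP; split.
  rewrite -natrB; last by lia.
  rewrite -!natrM -natrD ler_nat.
  (* The bounds [a <= k.+1] and [b <= k.+1] come from [a_hi], [b_hi] and [k >= 1]. *)
  by apply: gamma_kR_C5_path_le => //; clearbody a b; lia.
rewrite ler_pdivlMr // lerBrDr.
rewrite -natrB; last by lia.
rewrite -!(natrM, natrD) ler_nat.
(* [b_hi] and [a_lo] give [30 * b <= 8 * k + 42]. Adding three times the product bound below gives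
   at most [3nk + 24n + 2k - 6], within the target [3nk + 27n + 2k - 2]. *)
have : ((n - 2) * (5 * a) <= (n - 2) * (k + 8))%N by rewrite leq_mul2l a_hi orbT.
by clearbody a b; nia.
Qed.
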